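(* Let $l\ge1$, $n\ge1$, $\mu>0$, $1\le p<\infty$, $0<q\le\infty$, and let $H$ be a traceless Hermitian observable on $n$ qubits. Let $\mathcal C_{\hat\mu_{p,q}\le\mu}$ be the set of depth-$l$ circuits $\vec C_l=(\Phi_l,\dots,\Phi_1)$ of unital quantum channels on $n$ qubits with $\hat\mu_{p,q}(\vec C_l)\le\mu$, and $N=4^n-1$. Then for every sample $S=(\vec x_1,\dots,\vec x_m)$: (1) if $1\le p\le2$, $R_S(\mathcal F\circ\mathcal C_{\hat\mu_{p,q}\le\mu})\le\mu N^{l\max\{1/p^*,1/q\}}\frac{\sqrt{\min\{p^*,8n\}}}{\sqrt m}\hat K_p(S,H)$; (2) if $2<p<\infty$, $R_S(\mathcal F\circ\mathcal C_{\hat\mu_{p,q}\le\mu})\le\mu N^{l\max\{1/p^*,1/q\}}\frac{\sqrt{p^*}}{m^{1/p}}\hat K_p(S,H)$.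
   Context: Pauli notation $P_{\vec z}$ as tensor products of $P_0=\mathbb I,P_1=X,P_2=Y,P_3=Z$; $\vec0$ the all-zero string. Representation matrix: $M^\Phi_{\vec z\vec x}=2^{-n}\mathrm{Tr}(P_{\vec z}\Phi(P_{\vec x}))$; for unital $\Phi$ ($\Phi(\mathbb I)=\mathbb I$), $\hat M^\Phi$ is the submatrix with rows and columns indexed by strings $\ne\vec0$. Group norm: $\|M\|_{p,q}=(\frac1{N_1}\sum_i\|M_i\|_p^q)^{1/q}$ for an $N_1\times N_2$ matrix with rows $M_i$ ($\max_i\|M_i\|_p$ if $q=\infty$). $p^*$ is the Hölder conjugate. $\hat\mu_{p,q}(\vec C_l)=\prod_{i=1}^l\|\hat M^{\Phi_i}\|_{p,q}$. $C_l=\Phi_l\circ\cdots\circ\Phi_1$, $f_{\vec C_l}(\vec x)=\mathrm{Tr}(C_l(\rho(\vec x))H)$ with $\rho(\vec x)$ an $n$-qubit pure state encoding $\vec x$; $R_S(\mathcal G)=\mathbb E_{\vec\epsilon}\frac1m\sup_{g\in\mathcal G}|\sum_i\epsilon_ig(\vec x_i)|$ with i.i.d. uniform signs. $\hat{\vec\alpha}\in\mathbb R^N$ has entries $\mathrm{Tr}(P_{\vec z}H)$, $\hat{\vec f}_I(\vec x)\in\mathbb R^N$ has entries $2^{-n}\mathrm{Tr}(P_{\vec z}\rho(\vec x))$ (indices $\vec z\ne\vec0$), $\hat K_p(S,H)=\|\hat{\vec\alpha}\|_p\max_i\|\hat{\vec f}_I(\vec x_i)\|_{p^*}$. *)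

(* Defs.v *)
From HB Require Import structures.
From mathcomp Require Import all_boot all_order all_algebra.
From mathcomp Require Import all_classical all_reals all_analysis.
From mathcomp Require Import complex.
Set Implicit Arguments. Unset Strict Implicit. Unset Printing Implicit Defensive.
Import Order.TTheory GRing.Theory Num.Theory.
Local Open Scope ring_scope.
Local Open Scope classical_set_scope.

Definition adjmx (R : realType) (k l : nat) (A : 'M[R[i]]_(k, l)) : 'M[R[i]]_(l, k) :=
  (map_mx (@conjc R) A)^T.

Definition einv (R : realType) (r : \bar R) : R :=
  match r with EFin x => x^-1 | _ => 0 end.

Definition pstar (R : realType) (p : R) : \bar R :=
  if p == 1 then +oo%E else (p / (p - 1))%:E.

Definition lpnorm (R : realType) (p : \bar R) (I : finType) (P : pred I)
    (v : I -> R[i]) : R :=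
  match p with
  | +oo%E => \big[Num.max/0]_(i | P i) Normc.normc (v i)
  | EFin r => (\sum_(i | P i) (Normc.normc (v i)) `^ r) `^ r^-1
  | -oo%E => 0
  end.

Section Qubits.
Variable R : realType.
Local Notation C := R[i].

(* single-qubit Paulis P_0 = I, P_1 = X, P_2 = Y, P_3 = Z; entry (b,c) with
   rows/cols indexed by bits (false = |0>, true = |1>) *)
Definition pauli1 (a : 'I_4) (b c : bool) : C :=
  match val a with
  | 0 => if b == c then 1 else 0
  | 1 => if b == c then 0 else 1
  | 2 => if b == c then 0 else (if b then Complex 0 1 else - Complex 0 1)
  | _ => if b == c then (if b then -1 else 1) else 0
  end.

Variable n : nat.

Definition qbit (k : 'I_n) (i : 'I_(2 ^ n)) : bool := odd (i %/ 2 ^ k).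

Definition pstring := {ffun 'I_n -> 'I_4}.
Definition zero_str : pstring := [ffun => ord0].
Definition nzstr (z : pstring) : bool := z != zero_str.

(* P_z = P_{z_1} (x) ... (x) P_{z_n} *)
Definition pauli (z : pstring) : 'M[C]_(2 ^ n) :=
  \matrix_(i, j) \prod_(k < n) pauli1 (z k) (qbit k i) (qbit k j).

Definition qop := 'M[C]_(2 ^ n).

(* quantum channel: CPTP map, given in Kraus form *)
Definition is_channel (Phi : qop -> qop) : Prop :=
  exists ks : seq qop,
    (forall X : qop, Phi X = \sum_(K <- ks) K *m X *m adjmx K) /\
    \sum_(K <- ks) adjmx K *m K = 1%:M.

Definition unital (Phi : qop -> qop) : Prop := Phi 1%:M = 1%:M.

Definition pure_state (rho : qop) : Prop :=
  exists v : 'cV[C]_(2 ^ n), adjmx v *m v = 1%:M /\ rho = v *m adjmx v.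

Definition repmx (Phi : qop -> qop) (z x : pstring) : C :=
  ((2 ^ n)%:R)^-1 * \tr (pauli z *m Phi (pauli x)).

Definition Nstr : nat := (4 ^ n - 1)%N.

Definition groupnorm (p : R) (q : \bar R) (M : pstring -> pstring -> C) : R :=
  match q with
  | +oo%E => \big[Num.max/0]_(z | nzstr z) lpnorm p%:E nzstr (M z)
  | EFin r => ((Nstr%:R)^-1 * \sum_(z | nzstr z) (lpnorm p%:E nzstr (M z)) `^ r) `^ r^-1
  | -oo%E => 0
  end.

(* circuit (Phi_1; ...; Phi_l), applied Phi_1 first *)
Definition apply_circ (cs : seq (qop -> qop)) (X : qop) : qop :=
  foldl (fun Y F => F Y) X cs.

Definition muhat (p : R) (q : \bar R) (cs : seq (qop -> qop)) : R :=
  \prod_(F <- cs) groupnorm p q (repmx F).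

Definition circ_class (l : nat) (p : R) (q : \bar R) (mu : R) : set (seq (qop -> qop)) :=
  [set cs | size cs = l /\ (forall F, F \in cs -> is_channel F /\ unital F)
            /\ muhat p q cs <= mu].

Definition model_class (X : Type) (rho : X -> qop) (H : qop)
    (l : nat) (p : R) (q : \bar R) (mu : R) : set (X -> C) :=
  [set g | exists2 cs, circ_class l p q mu cs &
             g = fun x => \tr (apply_circ cs (rho x) *m H)].

Definition alpha_hat (H : qop) (z : pstring) : C := \tr (pauli z *m H).
Definition fI_hat (rho : qop) (z : pstring) : C :=
  ((2 ^ n)%:R)^-1 * \tr (pauli z *m rho).

Definition Khat (X : Type) (m : nat) (p : R) (H : qop) (rho : X -> qop)
    (xs : 'I_m -> X) : R :=
  lpnorm p%:E nzstr (alpha_hat H) *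
  \big[Num.max/0]_(i < m) lpnorm (pstar p) nzstr (fI_hat (rho (xs i))).

End Qubits.

(* empirical Rademacher complexity of a class of (real-valued, here given with
   complex type) functions; the absolute value is the complex modulus *)
Definition rademacher (R : realType) (X : Type) (m : nat) (G : set (X -> R[i]))
    (xs : 'I_m -> X) : \bar R :=
  (((2 ^ m * m)%:R : R)^-1)%:E *
  \sum_(eps : {ffun 'I_m -> bool})
     ereal_sup [set (Normc.normc (\sum_(i < m) (if eps i then 1 else -1) * g (xs i)))%:E
               | g in G].

(* Main.v *)
Require Import Defs.
From HB Require Import structures.
From mathcomp Require Import all_boot all_order all_algebra.
From mathcomp Require Import all_classical all_reals all_analysis.
From mathcomp Require Import complex.
From mathcomp Require Import ring lra.
Set Implicit Arguments. Unset Strict Implicit. Unset Printing Implicit Defensive.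
Import Order.TTheory GRing.Theory Num.Theory.
Local Open Scope ring_scope.

(** Since [H] is traceless and the channels are unital, [Tr (C(A) H)] only sees
    the nonzero Pauli coefficients of [A], on which each channel acts by its
    reduced representation matrix. Hoelder on every row, followed by a comparison
    of the [l^(p^* )] and normalized [l^q] norms of the row norms, shows that a layer
    expands the [l^(p^* )] norm by at most [N ^ max(1/p^*, 1/q)] times its group norm.
    By linearity the supremum over circuits is then controlled by the [l^(p^* )]
    norm of the Rademacher sum of the coefficient vectors.

    For [p^* >= 2] this norm is bounded by Khintchine's inequality with constant
    [sqrt r], obtained from the moment generating function; when [p^* > 8 n] it is
    applied with exponent [4 n], and [sqrt (4 n) (4 ^ n) ^ (1 / (4 n)) = sqrt (8 n)].
    For [p^* < 2] the second moment suffices. *)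

(** * Norms of nonnegative finite families *)

(** Same formula as [lpnorm], on real families, so that [lpnormE] holds by conversion. Exponents
    below 1 are kept because [q] ranges over all positive values. *)
Definition rnorm (R : realType) (s : \bar R) (I : finType) (P : pred I)
    (a : I -> R) : R :=
  match s with
  | +oo%E => \big[Num.max/0]_(i | P i) a i
  | EFin r => (\sum_(i | P i) (a i) `^ r) `^ r^-1
  | -oo%E => 0
  end.

Section RealNorms.
Variables (R : realType) (I : finType) (P : pred I).
Implicit Types (a b : I -> R) (r s : R) (e f : \bar R).

Lemma lpnormE e (v : I -> R[i]) :
  lpnorm e P v = rnorm e P (fun i => Normc.normc (v i)).
Proof. by []. Qed.

Lemma powR_invK r x : 0 < r -> 0 <= x -> (x `^ r) `^ r^-1 = x.
Proof. by move=> r0 x0; rewrite -powRrM mulfV ?gt_eqF// powRr1. Qed.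

Lemma powRV_K r x : 0 < r -> 0 <= x -> (x `^ r^-1) `^ r = x.
Proof. by move=> r0 x0; rewrite -powRrM mulVf ?gt_eqF// powRr1. Qed.

Lemma sum_powR_ge0 a r : 0 <= \sum_(i | P i) a i `^ r.
Proof. by apply: sumr_ge0 => i _; rewrite powR_ge0. Qed.

Lemma rnorm_ge0 a e : 0 <= rnorm e P a.
Proof.
case: e => [r||] //=; first exact: powR_ge0.
by elim/big_rec: _ => // i x _ x0; rewrite le_max x0 orbT.
Qed.

Lemma rnorm_pow a r : 0 < r -> rnorm r%:E P a `^ r = \sum_(i | P i) a i `^ r.
Proof. by move=> r0; rewrite /= powRV_K// sum_powR_ge0. Qed.

Lemma rnorm_le a r B : 0 < r -> 0 <= B ->
  (rnorm r%:E P a <= B) = (\sum_(i | P i) a i `^ r <= B `^ r).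
Proof.
move=> r0 B0; apply/idP/idP => h.
  by rewrite -rnorm_pow// ge0_ler_powR ?nnegrE ?rnorm_ge0// ltW.
rewrite /= -(powR_invK r0 B0).
by rewrite ge0_ler_powR ?nnegrE ?invr_ge0 ?sum_powR_ge0 ?powR_ge0 ?(ltW r0).
Qed.

Lemma ler_rnorm_coord a e i : (forall i, 0 <= a i) -> (0 < e)%E -> P i ->
  a i <= rnorm e P a.
Proof.
case: e => [r||] // a0 r0 Pi; last first.
  by rewrite /= (bigD1 i)//= le_max lexx.
rewrite lte_fin in r0.
rewrite -[leLHS](powR_invK r0)// /= ge0_ler_powR ?nnegrE ?invr_ge0 ?sum_powR_ge0 ?powR_ge0//; first exact: ltW.
by rewrite (bigD1 i)//= lerDl sumr_ge0// => j _; rewrite powR_ge0.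
Qed.

Lemma rnorm_infty_le a B : 0 <= B -> (forall i, P i -> a i <= B) ->
  rnorm +oo%E P a <= B.
Proof. by move=> B0 h /=; elim/big_rec: _ => // i x Pi x0; rewrite ge_max h. Qed.

Lemma ler_rnorm a b e : (0 < e)%E -> (forall i, 0 <= a i) ->
  (forall i, P i -> a i <= b i) -> rnorm e P a <= rnorm e P b.
Proof.
move=> e0 a0 ab; have b0 i : P i -> 0 <= b i by move=> /ab; apply: le_trans.
case: e e0 => [r r0||e0]; last by [].
- rewrite lte_fin in r0; rewrite rnorm_le ?rnorm_ge0 ?rnorm_pow ?r0//.
  apply: ler_sum => i Pi; apply: ge0_ler_powR (ltW r0) _ _ _ _ _.
  + exact: a0.
  + exact: b0.
  + exact: ab.
- move=> _; apply: rnorm_infty_le (rnorm_ge0 _ _) _ => i Pi.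
  apply: le_trans (ab i Pi) _.
  by rewrite /= (bigD1 i)//= le_max lexx.
Qed.

Lemma rnormZ a e c : (0 < e)%E -> 0 <= c -> (forall i, 0 <= a i) ->
  rnorm e P (fun i => a i * c) = rnorm e P a * c.
Proof.
case: e => [r||] // e0 c0 a0 /=; last first.
  elim/big_rec2: _ => [|i x y _ ->]; first by rewrite mul0r.
  by rewrite maxr_pMl.
rewrite lte_fin in e0.
under eq_bigr do rewrite powRM//.
rewrite -mulr_suml powRM ?sum_powR_ge0 ?powR_ge0//; congr (_ * _).
exact: powR_invK.
Qed.

(** Young's inequality, termwise, on the families divided by their norms; the sum is then at most
    [p^-1 + q^-1 = 1]. *)
Lemma hoelder_fin a b p q : (forall i, 0 <= a i) -> (forall i, 0 <= b i) ->
  0 < p -> 0 < q -> p^-1 + q^-1 = 1 ->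
  \sum_(i | P i) a i * b i <= rnorm p%:E P a * rnorm q%:E P b.
Proof.
move=> a0 b0 p0 q0 pq.
have normalized c r : 0 < r -> (forall i, 0 <= c i) -> 0 < rnorm r%:E P c ->
    \sum_(i | P i) (c i * (rnorm r%:E P c)^-1) `^ r = 1.
  move=> r0 c0 C0; under eq_bigr do rewrite powRM ?invr_ge0 ?rnorm_ge0//.
  rewrite -mulr_suml -rnorm_pow// -powRM ?invr_ge0 ?rnorm_ge0//.
  by rewrite mulfV ?gt_eqF// powR1.
have := normalized b q q0 b0; have := normalized a p p0 a0.
have := rnorm_ge0 a p%:E; have := rnorm_ge0 b q%:E.
have hA i : P i -> a i <= rnorm p%:E P a by exact: ler_rnorm_coord.
have hB i : P i -> b i <= rnorm q%:E P b by exact: ler_rnorm_coord.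
move: (rnorm p%:E P a) hA (rnorm q%:E P b) hB => A hA B hB Bge0 Age0 sumA sumB.
(* A zero norm cannot be divided out; the coordinate bound then makes every entry vanish. *)
have [A0|A0] := eqVneq A 0.
  rewrite A0 mul0r big1// => i Pi.
  by rewrite (_ : a i = 0) ?mul0r//; apply: le_anti; rewrite a0 -A0 hA.
have [B0|B0] := eqVneq B 0.
  rewrite B0 mulr0 big1// => i Pi.
  by rewrite (_ : b i = 0) ?mulr0//; apply: le_anti; rewrite b0 -B0 hB.
have {}A0 : 0 < A by rewrite lt_neqAle eq_sym A0.
have {}B0 : 0 < B by rewrite lt_neqAle eq_sym B0.
have {Age0}Ai : 0 <= A^-1 by rewrite invr_ge0.
have {Bge0}Bi : 0 <= B^-1 by rewrite invr_ge0.
have : \sum_(i | P i) (a i * A^-1) * (b i * B^-1) <= 1.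
  apply: (@le_trans _ _ (\sum_(i | P i) ((a i * A^-1) `^ p / p + (b i * B^-1) `^ q / q))).
    by apply: ler_sum => i Pi; apply: conjugate_powR => //; apply: mulr_ge0.
  by rewrite big_split/= -!mulr_suml sumA ?sumB// !mul1r pq.
under eq_bigr do rewrite mulrACA -invfM.
by rewrite -mulr_suml ler_pdivrMr ?mulr_gt0// mul1r.
Qed.

(** For finite exponents [s <= r], no entry exceeds the [l^s] norm [B], so
    [a i ^ r = a i ^ s * a i ^ (r - s)] is at most [a i ^ s * B ^ (r - s)]. *)
Lemma rnorm_antimono a e f : (forall i, 0 <= a i) -> (0 < e)%E -> (e <= f)%E ->
  rnorm f P a <= rnorm e P a.
Proof.
move=> a0 e0 ef.
case: f ef => [r ef||]; last 2 first.
- by move=> _; apply: rnorm_infty_le (rnorm_ge0 _ _) _ => i; exact: ler_rnorm_coord.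
- by rewrite leeNy_eq => /eqP ee; rewrite ee in e0.
case: e e0 ef => [s||e0].
2: by rewrite leye_eq.
2: by rewrite ltNge leNye in e0.
rewrite lte_fin lee_fin => s0 sr.
have r0 : 0 < r by exact: lt_le_trans sr.
rewrite rnorm_le ?rnorm_ge0//; set B := rnorm _ _ _.
have B0 : 0 <= B by exact: rnorm_ge0.
have split x : 0 <= x -> x `^ r = x `^ s * x `^ (r - s).
  have [->|x0 _] := eqVneq x 0; first by rewrite (@powR0 _ r) ?(@powR0 _ s) ?mul0r ?gt_eqF.
  by rewrite -powRD ?x0 ?implybT// subrKC.
rewrite split// rnorm_pow// mulr_suml; apply: ler_sum => i Pi.
rewrite split//; apply: ler_wpM2l; first exact: powR_ge0.
rewrite ge0_ler_powR ?nnegrE// ?subr_ge0//.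
by apply: ler_rnorm_coord; rewrite ?lte_fin.
Qed.

(** Hoelder for [a i ^ s] against the constant family 1, with exponent [r / s] and its conjugate;
    for infinite [f] each term is bounded by the maximum. *)
Lemma rnorm_power_mean a e f : (forall i, 0 <= a i) -> (0 < e)%E -> (e <= f)%E ->
  rnorm e P a <= #|P|%:R `^ (einv e - einv f) * rnorm f P a.
Proof.
move=> a0 e0 ef.
have [N0|N0] := eqVneq (#|P|%:R : R) 0.
  have P0 i : P i = false.
    by move/eqP: N0; rewrite pnatr_eq0 => /eqP /card0_eq /(_ i).
  suff -> : rnorm e P a = 0 by rewrite mulr_ge0 ?powR_ge0 ?rnorm_ge0.
  case: e e0 {ef} => [s||] //=; last by rewrite big_pred0.
  by rewrite lte_fin => s0; rewrite big_pred0// powR0// invr_eq0 gt_eqF.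
have N1 : 0 <= (#|P|%:R : R) by [].
case: e e0 ef => [s||e0].
2: by move=> _; rewrite leye_eq => /eqP ->; rewrite subrr powRr0 mul1r.
2: by rewrite ltNge leNye in e0.
rewrite lte_fin => s0.
case: f => [r||]; last 2 first.
- move=> _; rewrite rnorm_le ?mulr_ge0 ?powR_ge0 ?rnorm_ge0//= subr0.
  rewrite powRM ?powR_ge0 ?rnorm_ge0// ?powRV_K//.
    2: exact: (@rnorm_ge0 a +oo%E).
  apply: (@le_trans _ _ (\sum_(i | P i) (rnorm +oo%E P a) `^ s)).
    apply: ler_sum => i Pi; apply: ge0_ler_powR (ltW s0) _ _ _ _ _.
    - exact: a0.
    - exact: (@rnorm_ge0 a +oo%E).
    - exact: (@ler_rnorm_coord a +oo%E).
  by rewrite sumr_const mulr_natl.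
- by rewrite leeNy_eq.
rewrite lee_fin => sr; have r0 : 0 < r by exact: lt_le_trans sr.
(* At [s = r] the conjugate exponent [(1 - s / r)^-1] would be infinite, so equality is set
   apart. *)
move: sr; rewrite le_eqVlt => /predU1P[<-|sr].
  by rewrite subrr powRr0 mul1r.
rewrite rnorm_le ?mulr_ge0 ?powR_ge0 ?rnorm_ge0//.
have q0 : 0 < 1 - s / r by rewrite subr_gt0 ltr_pdivrMr// mul1r.
have q1 : (r / s)^-1 + ((1 - s / r)^-1)^-1 = 1 by rewrite invfM !invrK; ring.
have := @hoelder_fin (fun i => a i `^ s) (fun=> 1) _ _ (fun i => powR_ge0 _ _)
  (fun=> ler01) (divr_gt0 r0 s0) _ q1.
rewrite invr_gt0 => /(_ q0).
under eq_bigr do rewrite mulr1.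
move=> /le_trans; apply.
rewrite /= powRM ?powR_ge0//.
rewrite invrK invf_div mulrC.
under [X in X `^ (1 - _)]eq_bigr do rewrite powR1.
under [X in _ * X `^ (s / r)]eq_bigr do rewrite -powRrM mulrC divfK ?gt_eqF//.
rewrite sumr_const -!powRrM (mulrC r^-1) mulrBl mulVf ?gt_eqF//.
by rewrite (mulrC r^-1).
Qed.

(* With [f = q] and [e = p^*] the last factor is the group norm of a matrix
   whose rows have norms [a]. *)
Lemma rnorm_le_normalized a e f : (forall i, 0 <= a i) -> (0 < e)%E -> (0 < f)%E ->
  (0 < #|P|)%N ->
  rnorm e P a <= #|P|%:R `^ Num.max (einv e) (einv f) *
                 (#|P|%:R `^ (- einv f) * rnorm f P a).
Proof.
move=> a0 e0 f0 N0.
have N1 : 1 <= (#|P|%:R : R) by rewrite ler1n.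
rewrite mulrA -powRD; last by rewrite (gt_eqF (lt_le_trans ltr01 N1)) implybT.
have [ef|fe] := leP e f.
  apply: le_trans (rnorm_power_mean a0 e0 ef) _.
  apply: ler_wpM2r; first exact: rnorm_ge0.
  by apply: ler_powR => //; rewrite lerB// le_max lexx.
apply: le_trans (rnorm_antimono a0 f0 (ltW fe)) _.
rewrite -[leLHS]mul1r; apply: ler_wpM2r; first exact: rnorm_ge0.
rewrite -[leLHS](powRr0 #|P|%:R); apply: ler_powR => //.
by rewrite subr_ge0 le_max lexx orbT.
Qed.

End RealNorms.

(** * Hoelder conjugate exponents *)

Lemma pstar_ge1 (R : realType) (p : R) : 1 <= p -> (1 <= pstar p)%E.
Proof.
rewrite /pstar; case: eqVneq => [_ _|p1 hp]; first exact: leey.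
have {p1 hp} : 1 < p by rewrite lt_neqAle eq_sym p1.
by move=> h; rewrite lee_fin ler_pdivlMr; lra.
Qed.

Lemma pstar_gt0 (R : realType) (p : R) : 1 <= p -> (0 < pstar p)%E.
Proof. by move=> /pstar_ge1; apply: lt_le_trans; rewrite lte_fin. Qed.

Lemma hoelder_pstar (R : realType) (I : finType) (P : pred I) (a b : I -> R) (p : R) :
  (forall i, 0 <= a i) -> (forall i, 0 <= b i) -> 1 <= p ->
  \sum_(i | P i) a i * b i <= rnorm p%:E P a * rnorm (pstar p) P b.
Proof.
move=> a0 b0 p1; rewrite /pstar; case: eqVneq => [->|pn1].
  rewrite [rnorm 1%:E _ _]/= invr1 powRr1 ?sum_powR_ge0// mulr_suml.
  apply: ler_sum => i Pi; rewrite powRr1//; apply: ler_wpM2l => //.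
  exact: ler_rnorm_coord.
have {}p1 : 1 < p by rewrite lt_neqAle eq_sym pn1.
have p0 : 0 < p by lra.
apply: hoelder_fin => //; first by rewrite divr_gt0// subr_gt0.
by field; lra.
Qed.

(** * Khintchine's inequality and the type of l^r *)

Section Khintchine.
Variable R : realType.
Implicit Types (x y r lam : R) (m : nat).

(** With [y = 2 u], [E = exp u] and [F = exp (- u)], the left side is [1 + (E - F)^2 / 2], and
    [E - F] has a linear bound. The sharp coefficient is [1/2]; [3/5] leaves room for elementary
    estimates. *)
Lemma cosh_le_small y : 0 <= y -> y <= 5^-1 ->
  (expR y + expR (- y)) / 2 <= expR (3 / 5 * y ^+ 2).
Proof.
move=> y0 y1; apply: le_trans (expR_ge1Dx _).
pose u := y / 2.
have hF : 1 + - u <= expR (- u) by exact: expR_ge1Dx.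
have hEF := expRxMexpNx_1 u.
have -> : y = u + u by rewrite /u; field.
have hu : 0 <= u <= 10^-1 by rewrite /u; apply/andP; split; lra.
rewrite opprD !expRD; case/andP: hu => u0 u1.
have E0 := expR_gt0 u; have F0 := expR_gt0 (- u).
have E1 : 1 <= expR u by have := expR_ge1Dx u; lra.
move: (expR u) (expR (- u)) hF hEF E0 F0 E1 => E F hF hEF E0 F0 E1.
(* From [(1 - u) E <= F E = 1], as [(1 + 28/25 u) (1 - u) >= 1] for [0 <= u <= 3/28]. Then
   [E - F <= 53/25 u], and [(53/25)^2 / 2 <= 12/5 = 4 * 3/5]. *)
have hE : E <= 1 + 28 / 25 * u.
  rewrite -(ler_pM2r (_ : 0 < 1 - u)); last by lra.
  apply: (@le_trans _ _ 1); last by nra.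
  by rewrite -hEF; apply: ler_wpM2l; lra.
have F1 : F <= 1 by rewrite -hEF ler_peMl// ltW.
have hD : (E - F) ^+ 2 <= (53 / 25 * u) ^+ 2 by rewrite ler_sqr ?nnegrE; lra.
have -> : (E * E + F * F) / 2 = 1 + (E - F) ^+ 2 / 2.
  by lra.
have := sqr_ge0 u; nra.
Qed.

(* The bound propagates from [y] to [2 y] since cosh (2 y) = 2 c^2 - 1 <= c^4
   with c = cosh y. *)
Lemma cosh_le x : (expR x + expR (- x)) / 2 <= expR (3 / 5 * x ^+ 2).
Proof.
wlog x0 : x / 0 <= x => [hw|].
  have [/hw//|/ltW x0] := leP 0 x.
  by have := hw (- x); rewrite oppr_ge0 opprK sqrrN addrC; apply.
(* [k] counts the doublings that lead from the range of [cosh_le_small] to [x]. *)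
have [k] : exists k : nat, x <= 5^-1 * (2 ^ k)%:R.
  exists (Num.bound (5 * x)).
  have h := archi_boundP (_ : 0 <= 5 * x).
  have : 5 * x < (2 ^ Num.bound (5 * x))%:R.
    apply: lt_le_trans (h _) _; first by lra.
    by rewrite ler_nat ltnW// ltn_expl.
  by lra.
elim: k x x0 => [|k IH] x x0 hx.
  by apply: cosh_le_small; rewrite // -[leRHS]mulr1.
have hy : (expR (x / 2) + expR (- (x / 2))) / 2 <= expR (3 / 5 * (x / 2) ^+ 2).
  by apply: IH; [lra | move: hx; rewrite expnS natrM; lra].
have -> : 3 / 5 * x ^+ 2 = 4%:R * (3 / 5 * (x / 2) ^+ 2) by field.
rewrite expRM_natl.
set c := (expR (x / 2) + expR (- (x / 2))) / 2 in hy.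
have c0 : 0 <= c by rewrite divr_ge0// addr_ge0// expR_ge0.
apply: (@le_trans _ _ (c ^+ 4)); last by rewrite lerXn2r ?nnegrE ?expR_ge0.
have -> : expR x = expR (x / 2) ^+ 2 by rewrite -expRM_natl; congr expR; field.
have -> : expR (- x) = expR (- (x / 2)) ^+ 2 by rewrite -expRM_natl; congr expR; field.
have hEF := expRxMexpNx_1 (x / 2).
have -> : (expR (x / 2) ^+ 2 + expR (- (x / 2)) ^+ 2) / 2 = 2 * c ^+ 2 - 1.
  by rewrite /c; move: hEF; rewrite expr2 expr2; lra.
have := sqr_ge0 (c ^+ 2 - 1); rewrite sqrrB -exprM expr1n mulr1; lra.
Qed.

(** The threshold [12/5] is what makes [6 / (5 e) <= 1/2] in [khintchine]; the fourth power of
    [1 + 1/4] already exceeds it. *)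
Lemma expR1_ge : 12 / 5 <= expR 1 :> R.
Proof.
have -> : (1 : R) = 4%:R * 4^-1 by field.
rewrite expRM_natl; have h := expR_ge1Dx (4^-1 : R).
apply: (@le_trans _ _ ((1 + 4^-1) ^+ 4)); first by lra.
by rewrite lerXn2r ?nnegrE ?expR_ge0//; lra.
Qed.

(** The inequality [t <= exp (t - 1)] at [t = lam x / r], raised to the power [r]. It reduces [r]-th
    moments to exponential moments. *)
Lemma powR_le_expR x r lam : 0 <= x -> 0 < r -> 0 < lam ->
  x `^ r <= (r / lam) `^ r * (expR (- r) * expR (lam * x)).
Proof.
move=> x0 r0 l0.
have hc : 0 <= r / lam by rewrite divr_ge0// ltW.
have h : x <= r / lam * expR (lam * x / r - 1).
  have := ler_wpM2l hc (expR_ge1Dx (lam * x / r - 1)).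
  apply: le_trans; rewrite subrKC le_eqVlt; apply/orP; left; apply/eqP.
  by field; rewrite !gt_eqF.
apply: (le_trans (ge0_ler_powR (ltW r0) _ _ h)).
- exact: x0.
- by rewrite nnegrE mulr_ge0// expR_ge0.
rewrite powRM ?expR_ge0// -expRM -expRD le_eqVlt; apply/orP; left; apply/eqP.
by congr (_ * expR _); field; rewrite gt_eqF.
Qed.

Definition rsign (b : bool) : R := if b then 1 else -1.

Lemma rsignMrsign b : rsign b * rsign b = 1.
Proof. by case: b; rewrite /rsign ?mulrNN mulr1. Qed.

Definition signed_sum m (eps : {ffun 'I_m -> bool}) (a : 'I_m -> R) : R :=
  \sum_(i < m) rsign (eps i) * a i.

(** Independence of the signs: the sum over sign patterns factors into one hyperbolic cosine per
    coordinate, bounded by [cosh_le]. *)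
Lemma mgf_le m (a : 'I_m -> R) lam :
  \sum_(eps : {ffun 'I_m -> bool}) expR (lam * signed_sum eps a)
    <= 2 ^+ m * expR (3 / 5 * lam ^+ 2 * \sum_i a i ^+ 2).
Proof.
under eq_bigr do rewrite /signed_sum mulr_sumr expR_sum.
rewrite -(bigA_distr_bigA (fun i b => expR (lam * (rsign b * a i)))).
rewrite mulr_sumr expR_sum -[in X in X * _](card_ord m) -prodr_const -big_split/=.
apply: ler_prod => i _; rewrite big_bool/= /rsign mul1r mulN1r mulrN.
apply/andP; split; first by rewrite addr_ge0 ?expR_ge0.
have := cosh_le (lam * a i).
by rewrite exprMn mulrA; lra.
Qed.

(** Exponential moments at [lam] and [- lam] together dominate that of the absolute value, at the
    price of a factor 2. *)
Lemma khintchine m (a : 'I_m -> R) r : 2 <= r ->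
  \sum_(eps : {ffun 'I_m -> bool}) `|signed_sum eps a| `^ r
    <= 2 ^+ m * (r * \sum_i a i ^+ 2) `^ (r / 2).
Proof.
move=> r2; have r0 : 0 < r by lra.
have [V0|V0] := eqVneq (\sum_i a i ^+ 2) 0.
  have a0 i : a i = 0.
    apply/eqP; rewrite -sqrf_eq0; move/eqP: V0; rewrite psumr_eq0.
      by move=> /allP /(_ i); rewrite mem_index_enum => /(_ isT).
    by move=> j _; exact: sqr_ge0.
  rewrite big1 ?mulr_ge0 ?powR_ge0 ?exprn_ge0// => eps _.
  by rewrite /signed_sum big1 ?normr0 ?powR0 ?gt_eqF// => i _; rewrite a0 mulr0.
set V := \sum_i _ in V0 *.
have {}V0 : 0 < V.
  by rewrite lt_neqAle eq_sym V0 sumr_ge0// => i _; exact: sqr_ge0.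
(* This [lam] minimizes [(r / lam)^r exp (3/5 lam^2 V)]; the exponent in [mgf_le] becomes
   [r / 2]. *)
pose lam := Num.sqrt (5 * r / (6 * V)).
have l0 : 0 < lam by rewrite sqrtr_gt0 divr_gt0// mulr_gt0.
have l2 : lam ^+ 2 = 5 * r / (6 * V) by rewrite sqr_sqrtr// divr_ge0// mulr_ge0// ltW.
have h eps : `|signed_sum eps a| `^ r <= (r / lam) `^ r * (expR (- r) *
    (expR (lam * signed_sum eps a) + expR (- lam * signed_sum eps a))).
  apply: (le_trans (powR_le_expR (normr_ge0 _) r0 l0)).
  apply: ler_wpM2l; first exact: powR_ge0.
  apply: ler_wpM2l; first exact: expR_ge0.
  rewrite mulNr -mulrN; case: (ger0P (signed_sum eps a)) => _.
    by rewrite lerDl expR_ge0.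
  by rewrite lerDr expR_ge0.
apply: (le_trans (ler_sum _ (fun eps _ => h eps))).
rewrite -!mulr_sumr big_split/=.
have h1 := mgf_le a lam; have h2 := mgf_le a (- lam).
rewrite sqrrN -/V l2 in h2; rewrite -/V l2 in h1.
have ex : 3 / 5 * (5 * r / (6 * V)) * V = r / 2 by field; rewrite gt_eqF.
rewrite ex in h1 h2.
have -> : (r / lam) `^ r = (r * V) `^ (r / 2) * (6 / 5) `^ (r / 2).
  rewrite -powRM ?divr_ge0 ?mulr_ge0 ?(ltW r0) ?(ltW V0)//.
  have -> : r * V * (6 / 5) = (r / lam) ^+ 2.
    by rewrite exprMn exprVn l2; field; rewrite !gt_eqF.
  rewrite -powR_mulrn ?divr_ge0 ?(ltW r0) ?(ltW l0)// -powRrM; congr powR.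
  by field.
(* The factor 2 is absorbed here: the left side is [(6 / (5 e))^(r / 2)], whose base is at most
   [1/2] and whose exponent is at least 1. *)
have hc : (6 / 5) `^ (r / 2) * (expR (- r) * expR (r / 2)) <= 2^-1.
  rewrite -expRD (_ : - r + r / 2 = - 1 * (r / 2)); last by field.
  rewrite expRM -powRM ?expR_ge0//.
  apply: (@le_trans _ _ (2^-1 `^ (r / 2))).
    apply: ge0_ler_powR; rewrite ?nnegrE ?mulr_ge0 ?expR_ge0//; first by lra.
    rewrite expRN; have := expR1_ge; have := expR_gt0 (1 : R) => e0 e1.
    by rewrite ler_pdivrMr//; lra.
  rewrite -[leRHS]powRr1//; apply: ger_powR; last by lra.
  by rewrite invr_gt0 ltr0n/= invf_le1// ler1n.
set K := _ `^ _ in hc *; set W := _ `^ _.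
have W0 : 0 <= W by exact: powR_ge0.
have K0 : 0 <= K by exact: powR_ge0.
apply: (@le_trans _ _ (W * K * (expR (- r) * (2 * (2 ^+ m * expR (r / 2)))))).
  apply: ler_wpM2l; first exact: mulr_ge0.
  apply: ler_wpM2l; first exact: expR_ge0.
  by rewrite mulr_natl mulr2n lerD.
have -> : W * K * (expR (- r) * (2 * (2 ^+ m * expR (r / 2)))) =
    2 ^+ m * W * (2 * (K * (expR (- r) * expR (r / 2)))) by ring.
rewrite -[leRHS]mulr1; apply: ler_wpM2l; last by lra.
by rewrite mulr_ge0// exprn_ge0.
Qed.

(** Distinct signs are orthogonal, so only the diagonal of the expanded square survives. *)
Lemma second_moment m (a : 'I_m -> R) :
  \sum_(eps : {ffun 'I_m -> bool}) signed_sum eps a ^+ 2 = 2 ^+ m * \sum_i a i ^+ 2.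
Proof.
have orth i j : \sum_(eps : {ffun 'I_m -> bool}) rsign (eps i) * rsign (eps j) =
    (if i == j then 2 ^+ m else 0).
  have [<-|ij] := eqVneq i j.
    under eq_bigr do rewrite rsignMrsign.
    by rewrite sumr_const card_ffun card_bool card_ord natrX.
  (* As a product over all coordinates, the product of two signs can be summed factor by factor;
     coordinate [i] gives [1 - 1 = 0]. *)
  pose G k b := (if k == i then rsign b else 1) * (if k == j then rsign b else 1).
  under eq_bigr => eps _.
    rewrite (_ : _ * _ = \prod_k G k (eps k)); last first.
      by rewrite big_split/= -!big_mkcond/= !big_pred1_eq.
    over.
  rewrite -bigA_distr_bigA (bigD1 i)//= big_bool /G eqxx (negPf ij)/= /rsign.
  by rewrite !mulr1 subrr mul0r.
under eq_bigr do rewrite expr2 /signed_sum big_distrlr/=.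
rewrite exchange_big mulr_sumr; apply: eq_bigr => i _.
rewrite exchange_big (bigD1 i)//= [X in _ + X]big1 => [|j ji].
  under eq_bigr do rewrite mulrACA.
  by rewrite -mulr_suml orth eqxx addr0.
under eq_bigr do rewrite mulrACA.
by rewrite -mulr_suml orth eq_sym (negPf ji) mul0r.
Qed.

(** Jensen's inequality for the uniform mean on [T], unnormalized: the power mean inequality between
    exponents 1 and [r]. *)
Lemma mean_le_of_moment (T : finType) (Y : T -> R) r B : 1 <= r -> 0 <= B ->
  (forall t, 0 <= Y t) -> \sum_t Y t `^ r <= #|T|%:R * B `^ r ->
  \sum_t Y t <= #|T|%:R * B.
Proof.
move=> r1 B0 Y0 hY; have r0 : 0 < r by lra.
have r1' : (1%:E <= r%:E)%E by rewrite lee_fin.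
have e01 : (0 < 1%:E :> \bar R)%E by rewrite lte_fin.
have := rnorm_power_mean xpredT Y0 e01 r1'.
rewrite /= invr1 powRr1 ?sum_powR_ge0//.
under eq_bigr do rewrite powRr1//.
move=> /le_trans; apply.
have hc : #|xpredT : pred T|%:R = (#|T|%:R : R) by [].
rewrite hc; have [N0|N0] := eqVneq (#|T|%:R : R) 0.
  rewrite big1 ?powR0 ?invr_eq0 ?gt_eqF ?mulr0 ?N0 ?mul0r// => t _.
  by move/eqP: N0; rewrite pnatr_eq0 => /eqP /card0_eq /(_ t).
apply: (@le_trans _ _ (#|T|%:R `^ (1 - r^-1) * (#|T|%:R `^ r^-1 * B))).
  apply: ler_wpM2l; first exact: powR_ge0.
  rewrite -[X in _ * X](powR_invK r0 B0) -powRM ?powR_ge0//.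
  apply: ge0_ler_powR; rewrite ?invr_ge0 ?(ltW r0)//.
  - exact: sum_powR_ge0.
  - by rewrite nnegrE mulr_ge0 ?powR_ge0.
by rewrite mulrA -powRD ?N0 ?implybT// subrK powRr1.
Qed.

(** The power mean inequality over the signs raises the exponent to 2, [second_moment] evaluates the
    result, and the [l^2] norm of [a] is at most its [l^r] norm. *)
Lemma moment_le_second m (a : 'I_m -> R) r : 1 <= r -> r <= 2 ->
  \sum_(eps : {ffun 'I_m -> bool}) `|signed_sum eps a| `^ r
    <= 2 ^+ m * \sum_i `|a i| `^ r.
Proof.
move=> r1 r2; have r0 : 0 < r by lra.
have r2' : (r%:E <= 2%:E)%E by rewrite lee_fin.
have r0' : (0 < r%:E)%E by rewrite lte_fin.
have sq t : `|t| `^ 2 = t ^+ 2 :> R by rewrite powR_mulrn// real_normK// num_real.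
have := rnorm_power_mean (xpredT : pred {ffun 'I_m -> bool})
  (fun eps => normr_ge0 (signed_sum eps a)) r0' r2'.
rewrite rnorm_le ?mulr_ge0 ?powR_ge0 ?rnorm_ge0// => /le_trans; apply.
have -> : #|xpredT : pred {ffun 'I_m -> bool}|%:R = (2 ^+ m : R).
  by rewrite card_ffun card_bool card_ord natrX.
have hm : 0 < (2 ^+ m : R) by exact: exprn_gt0.
have h2 := rnorm_antimono xpredT (fun i => normr_ge0 (a i)) r0' r2'.
have -> : rnorm 2%:E xpredT (fun eps => `|signed_sum eps a|) =
    (2 ^+ m) `^ 2^-1 * rnorm 2%:E xpredT (fun i => `|a i|).
  rewrite /=; under eq_bigr do rewrite sq.
  under [in RHS]eq_bigr do rewrite sq.
  by rewrite second_moment powRM ?sumr_ge0 ?(ltW hm)// => i _; exact: sqr_ge0.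
rewrite mulrA -powRD ?(gt_eqF hm) ?implybT// subrK.
rewrite powRM ?powR_ge0 ?rnorm_ge0// powRV_K ?(ltW hm)//.
apply: ler_wpM2l; first exact: ltW.
move: h2; rewrite -(rnorm_pow _ _ r0).
by apply: (ge0_ler_powR (ltW r0)); rewrite nnegrE; exact: rnorm_ge0.
Qed.

End Khintchine.

(** * Rademacher sums of vectors in [l^r] *)

Lemma powR_half_invK (R : realType) (x r : R) : 0 <= x -> 0 < r ->
  (x `^ (r / 2)) `^ r^-1 = Num.sqrt x.
Proof.
move=> x0 r0; rewrite -powRrM -powR12_sqrt//; congr powR.
by field; rewrite gt_eqF.
Qed.

Section RademacherType.
Variables (R : realType) (I : finType) (P : pred I) (m : nat).
Variables (b : 'I_m -> I -> R) (D : R).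
Hypothesis D0 : 0 <= D.
Local Notation w := (fun (eps : {ffun 'I_m -> bool}) z => `|signed_sum eps (b^~ z)|).

(** Jensen passes to the [r]-th moment of the norm, which is a sum over coordinates; exchanging the
    sums leaves the scalar moment bound at each [z]. *)
Lemma rnorm_signed_sum_of_moment (r C : R) : 1 <= r -> 0 <= C ->
  (forall z, \sum_(eps : {ffun 'I_m -> bool}) w eps z `^ r
     <= 2 ^+ m * (C * \sum_i `|b i z| `^ r)) ->
  (forall i, rnorm r%:E P (fun z => `|b i z|) <= D) ->
  \sum_(eps : {ffun 'I_m -> bool}) rnorm r%:E P (w eps)
    <= 2 ^+ m * ((C * m%:R) `^ r^-1 * D).
Proof.
move=> r1 C0 hw hD; have r0 : 0 < r by lra.
have card2 : #|{ffun 'I_m -> bool}|%:R = (2 ^+ m : R).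
  by rewrite card_ffun card_bool card_ord natrX.
have hm : 0 <= (2 ^+ m : R) by exact: exprn_ge0.
have Cm : 0 <= C * m%:R by exact: mulr_ge0.
rewrite -card2; apply: (mean_le_of_moment r1).
- by rewrite mulr_ge0 ?powR_ge0.
- by move=> eps; exact: rnorm_ge0.
rewrite card2 powRM ?powR_ge0// powRV_K//.
under eq_bigr do rewrite rnorm_pow//.
rewrite exchange_big/=.
apply: (@le_trans _ _ (\sum_(z | P z) 2 ^+ m * (C * \sum_i `|b i z| `^ r))).
  by apply: ler_sum => z _; exact: hw.
rewrite -!mulr_sumr exchange_big/= -mulrA; apply: ler_wpM2l => //.
apply: ler_wpM2l => //.
apply: (@le_trans _ _ (\sum_(i < m) D `^ r)).
  by apply: ler_sum => i _; rewrite -rnorm_le.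
by rewrite sumr_const card_ord mulr_natl.
Qed.

Lemma rnorm_signed_sum_ge2 (r : R) : (0 < m)%N -> 2 <= r ->
  (forall i, rnorm r%:E P (fun z => `|b i z|) <= D) ->
  \sum_(eps : {ffun 'I_m -> bool}) rnorm r%:E P (w eps)
    <= 2 ^+ m * (Num.sqrt r * Num.sqrt m%:R * D).
Proof.
move=> m0 r2; have r0 : 0 < r by lra.
have mR : 0 < m%:R :> R by rewrite ltr0n.
(* [r^(r/2)] comes from Khintchine, [m^(r/2 - 1)] from comparing [l^2] with [l^r] over the [m]
   sample points. *)
pose C := r `^ (r / 2) * m%:R `^ (r / 2 - 1).
have C0 : 0 <= C by rewrite mulr_ge0 ?powR_ge0.
have -> : Num.sqrt r * Num.sqrt m%:R = (C * m%:R) `^ r^-1.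
  rewrite /C -mulrA -[X in _ * (_ * X)]powRr1 ?(ltW mR)//.
  rewrite -powRD ?(gt_eqF mR) ?implybT// subrK powRM ?powR_ge0//.
  by congr (_ * _); apply/esym/powR_half_invK => //; exact: ltW.
have r1 : 1 <= r by lra.
apply: (rnorm_signed_sum_of_moment r1 C0) => z.
 apply: (le_trans (khintchine _ r2)).
apply: ler_wpM2l; first exact: exprn_ge0.
have V0 : 0 <= \sum_i b i z ^+ 2 by apply: sumr_ge0 => i _; exact: sqr_ge0.
rewrite powRM ?(ltW r0)// /C -mulrA; apply: ler_wpM2l; first exact: powR_ge0.
have two : (0 < 2%:E :> \bar R)%E by rewrite lte_fin.
have r2' : (2%:E <= r%:E)%E by rewrite lee_fin.
have := rnorm_power_mean xpredT (fun i => normr_ge0 (b i z)) two r2'.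
rewrite /= card_ord.
under eq_bigr do rewrite powR_mulrn// real_normK ?num_real//.
move=> /(ge0_ler_powR (ltW r0)); rewrite !nnegrE powR_ge0 mulr_ge0 ?powR_ge0//.
move=> /(_ isT isT); rewrite powRM ?powR_ge0// powRV_K ?sum_powR_ge0//.
rewrite -!powRrM.
have -> : 2^-1 * r = r / 2 by rewrite mulrC.
by have -> : (2^-1 - r^-1) * r = r / 2 - 1 by field; rewrite gt_eqF.
Qed.

Lemma rnorm_signed_sum_le2 (r : R) : 1 <= r -> r <= 2 ->
  (forall i, rnorm r%:E P (fun z => `|b i z|) <= D) ->
  \sum_(eps : {ffun 'I_m -> bool}) rnorm r%:E P (w eps)
    <= 2 ^+ m * (m%:R `^ r^-1 * D).
Proof.
move=> r1 r2 hD; rewrite -[m%:R]mul1r.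
apply: (rnorm_signed_sum_of_moment r1) => // z.
by rewrite mul1r; exact: moment_le_second.
Qed.

End RademacherType.

(* Passing from the exponent [e] to [s = 4 n] costs [(4 ^ n) `^ s^-1 = sqrt 2]. *)
Lemma rnorm_signed_sum_card (R : realType) (I : finType) (P : pred I) (m : nat)
    (b : 'I_m -> I -> R) (D : R) (e : \bar R) (n : nat) : 0 <= D -> (0 < m)%N -> (0 < n)%N ->
  (#|P| <= 4 ^ n)%N -> (((4 * n)%:R)%:E <= e)%E ->
  (forall i, rnorm e P (fun z => `|b i z|) <= D) ->
  \sum_(eps : {ffun 'I_m -> bool}) rnorm e P (fun z => `|signed_sum eps (b^~ z)|)
    <= 2 ^+ m * (Num.sqrt (8 * n)%:R * Num.sqrt m%:R * D).
Proof.
move=> D0 m0 n0 cardP se hD; set s : R := (4 * n)%:R in se.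
have n1 : 1 <= n%:R :> R by rewrite ler1n.
have sE : s = 4 * n%:R by rewrite /s natrM.
have s0 : (0 < s%:E)%E by rewrite lte_fin; lra.
have N0 : 0 <= #|P|%:R :> R by [].
(* The comparison goes through the maximum norm, which the [l^e] norm dominates. *)
have hs i : rnorm s%:E P (fun z => `|b i z|) <= Num.sqrt 2 * D.
  have se' : (s%:E <= +oo :> \bar R)%E by exact: leey.
  have := rnorm_power_mean P (fun z => normr_ge0 (b i z)) s0 se'.
  move=> /le_trans; apply; apply: ler_pM; rewrite ?powR_ge0 ?rnorm_ge0//=.
    rewrite subr0; apply: (@le_trans _ _ ((4 ^ n)%:R `^ s^-1)).
      rewrite lte_fin in s0; apply: ge0_ler_powR.
      - by rewrite invr_ge0 ltW.
      - by rewrite nnegrE.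
      - by rewrite nnegrE.
      - by rewrite ler_nat.
    have -> : (4 ^ n)%:R = (2 `^ 2^-1) `^ s :> R.
      rewrite -powRrM sE (_ : 2^-1 * _ = n%:R * 2); last by field.
      rewrite mulrC powRrM !powR_mulrn//.
      by rewrite -!natrX.
    by rewrite lte_fin in s0; rewrite powR_invK ?powR_ge0// powR12_sqrt.
  have e0 : (0 < e)%E by exact: lt_le_trans se.
  have ee : (e <= +oo)%E by exact: leey.
  exact: le_trans (rnorm_antimono P (fun z => normr_ge0 (b i z)) e0 ee) (hD i).
apply: (@le_trans _ _ (\sum_(eps : {ffun 'I_m -> bool}) 
    rnorm s%:E P (fun z => `|signed_sum eps (b^~ z)|))).
  apply: ler_sum => eps _.
  exact: (rnorm_antimono P (fun z => normr_ge0 (signed_sum eps (b^~ z)))).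
rewrite (_ : Num.sqrt (8 * n)%:R = Num.sqrt s * Num.sqrt 2 :> R); last first.
  by rewrite -sqrtrM ?ler0n// /s -natrM mulnAC.
have D2 : 0 <= Num.sqrt 2 * D by rewrite mulr_ge0 ?sqrtr_ge0.
have s2 : 2 <= s by lra.
have := rnorm_signed_sum_ge2 D2 m0 s2 hs.
by congr (_ <= _); ring.
Qed.

(** * Pauli expansion *)

Section Pauli.
Variables (R : realType) (n : nat).
Local Notation C := R[i].
Local Notation str := (pstring n).
Implicit Types (z : str) (A : 'M[C]_(2 ^ n)).

Lemma normc_ge0 (x : C) : 0 <= Normc.normc x.
Proof. by case: x => a b; exact: sqrtr_ge0. Qed.

Lemma qbit_inj (i j : 'I_(2 ^ n)) : (forall k, qbit k i = qbit k j) -> i = j.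
Proof.
(* Induction on the number of binary digits, splitting off the lowest one; stated on [nat] because
   the width varies. *)
have aux N : forall a b : nat, (a < 2 ^ N)%N -> (b < 2 ^ N)%N ->
    (forall k, (k < N)%N -> odd (a %/ 2 ^ k) = odd (b %/ 2 ^ k)) -> a = b.
  elim: N => [|N IH] a b; first by rewrite expn0 !ltnS !leqn0 => /eqP-> /eqP->.
  move=> ha hb hk; rewrite (divn_eq a 2) (divn_eq b 2) !modn2.
  congr (_ * 2 + nat_of_bool _)%N; last by have := hk 0%N isT; rewrite expn0 !divn1.
  apply: IH => [||k kN]; rewrite ?ltn_divLR// -?expnSr//.
  by rewrite -!divnMA -!expnS; exact: hk.
move=> h; apply/val_inj/(aux n) => //= k kn.
exact: (h (Ordinal kn)).
Qed.

Definition bits (i : 'I_(2 ^ n)) : {ffun 'I_n -> bool} := [ffun k => qbit k i].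

(** Turns a sum over matrix indices into a sum over bit patterns, which distributes over the tensor
    factors. *)
Lemma bits_bij : bijective bits.
Proof.
apply: inj_card_bij; last by rewrite card_ffun card_bool !card_ord.
by move=> i j /ffunP h; apply: qbit_inj => k; have := h k; rewrite !ffunE.
Qed.

Lemma pauli1_tr (a : 'I_4) : \sum_(b : bool) pauli1 R a b b = if a == ord0 then 2 else 0.
Proof.
by case: a => -[|[|[|[|//]]]] h; rewrite big_bool /pauli1/= ?addr0// addNr.
Qed.

(** The trace is multiplicative over tensor factors, and at least one factor is a traceless [X], [Y]
    or [Z]. *)
Lemma tr_pauli z : nzstr z -> \tr (pauli R z) = 0.
Proof.
move=> nz; rewrite /mxtrace.
under eq_bigr => i _.
  rewrite mxE (_ : \prod_ _ _ = \prod_k pauli1 R (z k) (bits i k) (bits i k)); last first.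
    by apply: eq_bigr => k _; rewrite !ffunE.
  over.
rewrite -(reindex bits (F := fun f : {ffun 'I_n -> bool} => \prod_k pauli1 R (z k) (f k) (f k)) (P:=xpredT)) /=; last first.
  exact: onW_bij bits_bij.
rewrite -(bigA_distr_bigA (fun k b => pauli1 R (z k) b b)).
have [k zk] : exists k, z k != ord0.
  apply/existsP; apply: contraT; rewrite negb_exists => /forallP h.
  case/eqP: nz; apply/ffunP => k; rewrite ffunE.
  by apply/eqP; have := h k; rewrite negbK.
by rewrite (bigD1 k)//= pauli1_tr (negPf zk) mul0r.
Qed.

Lemma pauli_zero : pauli R (zero_str n) = 1%:M.
Proof.
apply/matrixP => i j; rewrite !mxE.
have [->|ij] := eqVneq i j.
  by rewrite big1// => k _; rewrite ffunE /pauli1/= eqxx.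
have [k hk] : exists k, qbit k i != qbit k j.
  apply/existsP; apply: contraT; rewrite negb_exists => /forallP h.
  by case/eqP: ij; apply: qbit_inj => k; apply/eqP; have := h k; rewrite negbK.
by rewrite (bigD1 k)//= ffunE /pauli1/= (negPf hk) mul0r.
Qed.

(** Entrywise form of the identity that the sum of all [P_a] tensor [P_a] is twice the swap
    operator. *)
Lemma pauli1_complete (b c d e : bool) :
  \sum_(a < 4) pauli1 R a b c * pauli1 R a d e = if (b == e) && (c == d) then 2 else 0.
Proof.
have ii : Complex 0 1 * Complex 0 1 = -1 :> C.
  by apply/eqP; rewrite eq_complex/=; apply/andP; split; apply/eqP; ring.
rewrite !big_ord_recr big_ord0/= /pauli1/=.
by case: b; case: c; case: d; case: e => /=;
  rewrite ?(mulNr, mulrN, opprK) ?ii; ring.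
Qed.

Lemma pauli_complete (i j k l : 'I_(2 ^ n)) :
  \sum_z pauli R z i j * pauli R z k l = if (i == l) && (j == k) then (2 ^ n)%:R else 0.
Proof.
under eq_bigr do rewrite !mxE -big_split/=.
rewrite -(bigA_distr_bigA (fun t a => pauli1 R a (qbit t i) (qbit t j) * pauli1 R a (qbit t k) (qbit t l))).
under eq_bigr do rewrite pauli1_complete.
case: ifP => [/andP[/eqP-> /eqP->]|].
  under eq_bigr do rewrite !eqxx/=.
  by rewrite prodr_const card_ord natrX.
move=> h; have [t ht] : exists t, ~~ ((qbit t i == qbit t l) && (qbit t j == qbit t k)).
  apply/existsP; apply: contraFT h; rewrite negb_exists => /forallP h.
  by apply/andP; split; apply/eqP/qbit_inj => t; have := h t;
    rewrite negbK => /andP[/eqP ? /eqP ?].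
by rewrite (bigD1 t)//= (negPf ht) mul0r.
Qed.

(** Contraction of [pauli_complete] with the entries of [A]. *)
Lemma pauli_expansion A : A = \sum_z fI_hat A z *: pauli R z.
Proof.
have N0 : (2 ^ n)%:R != 0 :> C by rewrite pnatr_eq0 expn_eq0.
apply/matrixP => i j; rewrite summxE.
transitivity ((2 ^ n)%:R^-1 * \sum_z \tr (pauli R z *m A) * pauli R z i j); last first.
  by rewrite mulr_sumr; apply: eq_bigr => z _; rewrite [RHS]mxE mulrA.
have -> : \sum_z \tr (pauli R z *m A) * pauli R z i j =
    \sum_k \sum_l A l k * \sum_z pauli R z k l * pauli R z i j.
  under eq_bigr => z _.
    rewrite /mxtrace mulr_suml.
    under eq_bigr do rewrite mxE mulr_suml.
    over.
  rewrite exchange_big; apply: eq_bigr => k _.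
  rewrite exchange_big; apply: eq_bigr => l _.
  by rewrite mulr_sumr; apply: eq_bigr => z _; rewrite mulrA [A l k * _]mulrC.
under eq_bigr do under eq_bigr do rewrite pauli_complete.
rewrite (bigD1 j)//= (bigD1 i)//= !eqxx/= big1 => [|l li]; last first.
  by rewrite (negPf li) mulr0.
rewrite addr0 big1 => [|k kj]; last first.
  by rewrite big1// => l _; rewrite (negPf kj) mulr0.
by rewrite addr0 mulrC mulfK.
Qed.

(** After expanding [A], the identity string contributes a multiple of [\tr H = 0]. *)
Lemma tr_mul_nzstr A (H : 'M[C]_(2 ^ n)) : \tr H = 0 ->
  \tr (A *m H) = \sum_(z | nzstr z) fI_hat A z * alpha_hat H z.
Proof.
move=> H0; rewrite {1}(pauli_expansion A) mulmx_suml raddf_sum/=.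
rewrite (bigD1 (zero_str n))//= -scalemxAl mxtraceZ pauli_zero mul1mx H0 mulr0 add0r.
by apply: eq_bigr => z _; rewrite -scalemxAl mxtraceZ.
Qed.

(** Combinations over an arbitrary finite type serve both the Pauli expansion and the signed sum of
    sample states. *)
Definition linear_fun (F : 'M[C]_(2 ^ n) -> 'M[C]_(2 ^ n)) :=
  forall (I : finType) (P : pred I) (c : I -> C) (A : I -> 'M[C]_(2 ^ n)),
    F (\sum_(i | P i) c i *: A i) = \sum_(i | P i) c i *: F (A i).

Lemma channel_linear F : is_channel F -> linear_fun F.
Proof.
case=> ks [hF _] I P c A; rewrite hF.
under [RHS]eq_bigr do rewrite hF scaler_sumr.
rewrite [RHS]exchange_big/=; apply: eq_bigr => K _.
rewrite mulmx_sumr mulmx_suml; apply: eq_bigr => i _.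
by rewrite -scalemxAr -scalemxAl.
Qed.

(** Unitality keeps the identity component of [A] a multiple of the identity, which the traceless
    [pauli R z] does not see. *)
Lemma fI_hat_unital F A z : is_channel F -> unital F -> nzstr z ->
  fI_hat (F A) z = \sum_(x | nzstr x) repmx F z x * fI_hat A x.
Proof.
move=> /channel_linear linF F1 nz.
rewrite {1}(pauli_expansion A) linF /fI_hat mulmx_sumr raddf_sum/=.
rewrite (bigD1 (zero_str n))//= -scalemxAr mxtraceZ pauli_zero F1 mulmx1.
rewrite tr_pauli// mulr0 add0r mulr_sumr; apply: eq_bigr => x _.
by rewrite -scalemxAr mxtraceZ /repmx /fI_hat; ring.
Qed.

Lemma card_nzstr : #|@nzstr n| = Nstr n.
Proof.
have -> : #|@nzstr n| = #|predC1 (zero_str n)| by apply: eq_card.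
by rewrite cardC1 card_ffun !card_ord /Nstr subn1.
Qed.

Lemma conjc_pauli z i j : conjc (pauli R z i j) = pauli R z j i.
Proof.
rewrite !mxE rmorph_prod; apply: eq_bigr => k _; rewrite /pauli1.
case: (z k) => -[|[|[|[|//]]]] h /=; case: (qbit k i); case: (qbit k j) => /=;
  by apply/eqP; rewrite eq_complex/= ?(oppr0, opprK) !eqxx.
Qed.

(** The trace of a product of two Hermitian matrices is its own conjugate. The moment inequalities
    above concern real coefficients. *)
Lemma fI_hat_real A z : adjmx A = A -> exists t : R, fI_hat A z = t%:C%C.
Proof.
move=> hA.
have hc (u v : C) : conjc (u * v) = conjc u * conjc v by exact: rmorphM.
have htr : conjc (\tr (pauli R z *m A)) = \tr (pauli R z *m A).
  rewrite /mxtrace rmorph_sum/=; under eq_bigr do rewrite mxE rmorph_sum/=.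
  rewrite exchange_big; apply: eq_bigr => i _; rewrite mxE; apply: eq_bigr => j _.
  by rewrite hc conjc_pauli -{2}hA !mxE.
have : conjc (fI_hat A z) = fI_hat A z.
  by rewrite /fI_hat hc htr fmorphV rmorph_nat.
case: (fI_hat A z) => a b [] hb; exists a; congr Complex.
by lra.
Qed.

End Pauli.

(** * Unital circuits *)

Section Circuits.
Variables (R : realType) (n : nat).
Local Notation C := R[i].
Implicit Types (F : 'M[C]_(2 ^ n) -> 'M[C]_(2 ^ n)) (A : 'M[C]_(2 ^ n)).
Implicit Types (p : R) (q : \bar R).

Lemma normc_sum_le (I : finType) (P : pred I) (v : I -> C) :
  Normc.normc (\sum_(i | P i) v i) <= \sum_(i | P i) Normc.normc (v i).
Proof.
elim/big_rec2: _ => [|i y x _ h]; first by rewrite Normc.normc0.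
by apply: le_trans (le_normcD _ _) _; rewrite lerD2l.
Qed.

Lemma lpnorm_ge0 e (I : finType) (P : pred I) (v : I -> C) : 0 <= lpnorm e P v.
Proof. by rewrite lpnormE; exact: rnorm_ge0. Qed.

Lemma normc_dot_le (I : finType) (P : pred I) (u v : I -> C) p : 1 <= p ->
  Normc.normc (\sum_(i | P i) u i * v i) <= lpnorm p%:E P u * lpnorm (pstar p) P v.
Proof.
move=> p1; apply: le_trans (normc_sum_le _ _) _.
under eq_bigr do rewrite Normc.normcM.
by rewrite !lpnormE; apply: hoelder_pstar => // i; exact: normc_ge0.
Qed.

Lemma Nstr_gt0 : (1 <= n)%N -> (0 < Nstr n)%N.
Proof. by move=> n1; rewrite /Nstr subn_gt0 (@ltn_exp2l 4 0). Qed.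

(** Pulling out [1 / N] as [N^(- 1/q)] gives finite and infinite [q] the common shape of
    [rnorm_le_normalized]. *)
Lemma groupnormE p q (M : pstring n -> pstring n -> C) : (0 < q)%E ->
  groupnorm p q M =
    (Nstr n)%:R `^ (- einv q) * rnorm q (@nzstr n) (fun z => lpnorm p%:E (@nzstr n) (M z)).
Proof.
case: q => [r||q0]; last by rewrite ltNge leNye in q0.
- rewrite lte_fin => r0; rewrite /groupnorm powRM ?invr_ge0 ?sum_powR_ge0//.
  by rewrite -powR_inv1// -powRrM mulN1r.
- by move=> _; rewrite /= oppr0 powRr0 mul1r.
Qed.

Lemma groupnorm_ge0 p q (M : pstring n -> pstring n -> C) : (0 < q)%E ->
  0 <= groupnorm p q M.
Proof. by move=> q0; rewrite groupnormE// mulr_ge0 ?powR_ge0 ?rnorm_ge0. Qed.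

Lemma lpnorm_channel F A p q : (1 <= n)%N -> 1 <= p -> (0 < q)%E ->
  is_channel F -> unital F ->
  lpnorm (pstar p) (@nzstr n) (fI_hat (F A)) <=
    (Nstr n)%:R `^ Num.max (einv (pstar p)) (einv q) * groupnorm p q (repmx F)
      * lpnorm (pstar p) (@nzstr n) (fI_hat A).
Proof.
move=> n1 p1 q0 chF uF.
pose a z := lpnorm p%:E (@nzstr n) (repmx F z).
have a0 z : 0 <= a z by exact: lpnorm_ge0.
have L0 : 0 <= lpnorm (pstar p) (@nzstr n) (fI_hat A) by exact: lpnorm_ge0.
have s0 := pstar_gt0 p1.
apply: (@le_trans _ _ (rnorm (pstar p) (@nzstr n)
    (fun z => a z * lpnorm (pstar p) (@nzstr n) (fI_hat A)))).
  rewrite lpnormE; apply: ler_rnorm => // [z|z nz]; first exact: normc_ge0.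
  by rewrite fI_hat_unital//; exact: normc_dot_le.
rewrite rnormZ//; apply: ler_wpM2r => //.
rewrite groupnormE// -card_nzstr; apply: rnorm_le_normalized => //.
by rewrite card_nzstr Nstr_gt0.
Qed.

Definition unital_circuit (cs : seq ('M[C]_(2 ^ n) -> 'M[C]_(2 ^ n))) :=
  forall F, F \in cs -> is_channel F /\ unital F.

Lemma lpnorm_circuit cs A p q : (1 <= n)%N -> 1 <= p -> (0 < q)%E ->
  unital_circuit cs ->
  lpnorm (pstar p) (@nzstr n) (fI_hat (apply_circ cs A)) <=
    ((Nstr n)%:R `^ Num.max (einv (pstar p)) (einv q)) ^+ size cs * muhat p q cs
      * lpnorm (pstar p) (@nzstr n) (fI_hat A).
Proof.
move=> n1 p1 q0; set c := _ `^ _.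
have c0 : 0 <= c by exact: powR_ge0.
(* [apply_circ] is a left fold, so the induction hypothesis is needed at [F A] and [A] stays
   general. *)
elim: cs A => [|F cs IH] A hcs; first by rewrite /muhat big_nil expr0 !mul1r.
have [chF uF] : is_channel F /\ unital F by apply: hcs; rewrite mem_head.
have {}hcs : unital_circuit cs by move=> G Gcs; apply: hcs; rewrite in_cons Gcs orbT.
apply: (le_trans (IH (F A) hcs)).
have mu0 : 0 <= muhat p q cs by apply: prodr_ge0 => G _; exact: groupnorm_ge0.
apply: (le_trans (ler_wpM2l _ (lpnorm_channel A n1 p1 q0 chF uF))).
  by rewrite mulr_ge0// exprn_ge0.
rewrite -/c /muhat big_cons exprS le_eqVlt; apply/orP; left; apply/eqP.
by rewrite -/(muhat p q cs); ring.
Qed.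

Lemma circuit_linear cs : unital_circuit cs -> linear_fun (apply_circ cs).
Proof.
elim: cs => [|F cs IH] hcs I P c A //.
have [chF _] : is_channel F /\ unital F by apply: hcs; rewrite mem_head.
rewrite /apply_circ/= (channel_linear chF); apply: IH => G Gcs.
by apply: hcs; rewrite in_cons Gcs orbT.
Qed.

Lemma pure_state_hermitian A : pure_state A -> adjmx A = A.
Proof.
case=> v [_ ->]; rewrite /adjmx map_mxM trmx_mul; congr (_ *m _).
by apply/matrixP => i j; rewrite !mxE; exact: conjcK.
Qed.

Lemma fI_hat_sum (I : finType) (c : I -> C) (A : I -> 'M[C]_(2 ^ n)) z :
  fI_hat (\sum_i c i *: A i) z = \sum_i c i * fI_hat (A i) z.
Proof.
rewrite /fI_hat mulmx_sumr raddf_sum mulr_sumr; apply: eq_bigr => i _ /=.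
by rewrite -scalemxAr mxtraceZ mulrCA.
Qed.

(** Generalized Bloch coordinates; for Hermitian [A] the real part is the whole coefficient. *)
Definition bloch A z : R := complex.Re (fI_hat A z).

Lemma fI_hat_bloch A z : adjmx A = A -> fI_hat A z = (bloch A z)%:C%C.
Proof. by move=> /fI_hat_real - /(_ z)[t ht]; rewrite /bloch ht. Qed.

Lemma normc_real (t : R) : Normc.normc t%:C%C = `|t|.
Proof. by rewrite /= expr0n/= addr0 sqrtr_sqr. Qed.

End Circuits.

(** * From Rademacher complexity to Rademacher sums of Bloch vectors *)

Section Reduction.
Variables (R : realType) (n l m : nat) (mu p : R) (q : \bar R).
Variables (X : Type) (rho : X -> 'M[R[i]]_(2 ^ n)) (H : 'M[R[i]]_(2 ^ n)).
Variable xs : 'I_m -> X.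
Hypotheses (n1 : (1 <= n)%N) (mu0 : 0 < mu) (p1 : 1 <= p) (q0 : (0 < q)%E).
Hypotheses (trH : \tr H = 0) (pure : forall x, pure_state (rho x)).
Local Notation b := (fun i z => bloch (rho (xs i)) z).
Local Notation Nl :=
  ((Nstr n)%:R `^ (l%:R * Num.max (einv (pstar p)) (einv q)) : R).

Lemma lpnorm_fI_hat_bloch i : lpnorm (pstar p) (@nzstr n) (fI_hat (rho (xs i))) =
  rnorm (pstar p) (@nzstr n) (fun z => `|b i z|).
Proof.
rewrite lpnormE; congr rnorm; apply/funext => z.
by rewrite fI_hat_bloch ?normc_real//; exact: pure_state_hermitian.
Qed.

(** The right side does not depend on the circuit behind [g], so it bounds the supremum for each
    sign pattern. *)
Lemma signed_model_le (eps : {ffun 'I_m -> bool}) (g : X -> R[i]) :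
  model_class rho H l p q mu g ->
  Normc.normc (\sum_(i < m) (if eps i then 1 else -1) * g (xs i)) <=
    mu * Nl * lpnorm p%:E (@nzstr n) (alpha_hat H) *
    rnorm (pstar p) (@nzstr n) (fun z => `|signed_sum eps (b^~ z)|).
Proof.
case=> cs [szcs [hcs mucs]] ->.
pose s i : R[i] := (rsign R (eps i))%:C%C.
have sE i : (if eps i then 1 else -1) = s i.
  rewrite /s /rsign; case: (eps i) => //.
  by apply/eqP; rewrite eq_complex/= oppr0 !eqxx.
(* Linearity gathers the signed sample into one operator, which passes through the circuit once. *)
pose A := \sum_i s i *: rho (xs i).
have -> : \sum_(i < m) (if eps i then 1 else -1) * \tr (apply_circ cs (rho (xs i)) *m H) =
    \tr (apply_circ cs A *m H).
  rewrite (circuit_linear hcs) mulmx_suml raddf_sum; apply: eq_bigr => i _ /=.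
  by rewrite sE -scalemxAl mxtraceZ.
rewrite tr_mul_nzstr//; under eq_bigr do rewrite mulrC.
apply: (le_trans (normc_dot_le _ _ _ p1)).
have a0 : 0 <= lpnorm p%:E (@nzstr n) (alpha_hat H) by exact: lpnorm_ge0.
rewrite [mu * _ * _]mulrC -mulrA; apply: ler_wpM2l => //.
apply: (le_trans (lpnorm_circuit A n1 p1 q0 hcs)).
rewrite szcs (mulrC l%:R) powRrM powR_mulrn ?powR_ge0//.
have -> : lpnorm (pstar p) (@nzstr n) (fI_hat A) =
    rnorm (pstar p) (@nzstr n) (fun z => `|signed_sum eps (b^~ z)|).
  rewrite lpnormE; congr rnorm; apply/funext => z.
  rewrite fI_hat_sum /signed_sum -normc_real rmorph_sum; congr Normc.normc.
  apply: eq_bigr => i _; rewrite fI_hat_bloch; last exact: pure_state_hermitian.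
  by rewrite rmorphM.
apply: ler_wpM2r; first exact: rnorm_ge0.
by rewrite mulrC; apply: ler_wpM2r => //; rewrite exprn_ge0// powR_ge0.
Qed.

Lemma rademacher_model_le (B : R) : (0 < m)%N ->
  \sum_(eps : {ffun 'I_m -> bool})
     rnorm (pstar p) (@nzstr n) (fun z => `|signed_sum eps (b^~ z)|) <= 2 ^+ m * B ->
  (rademacher (model_class rho H l p q mu) xs <=
   (mu * Nl * lpnorm p%:E (@nzstr n) (alpha_hat H) * (B / m%:R))%:E)%E.
Proof.
move=> m0 hB; set K := mu * Nl * _.
have K0 : 0 <= K by rewrite !mulr_ge0 ?powR_ge0 ?(ltW mu0)//; exact: lpnorm_ge0.
have mR : m%:R != 0 :> R by rewrite pnatr_eq0 -lt0n.
have tm : 2 ^+ m != 0 :> R by rewrite expf_neq0// pnatr_eq0.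
rewrite /rademacher.
apply: (@le_trans _ _ (((2 ^ m * m)%:R^-1)%:E * (\sum_(eps : {ffun 'I_m -> bool})
    (K * rnorm (pstar p) (@nzstr n) (fun z => `|signed_sum eps (b^~ z)|))%:E))%E).
  apply: lee_wpmul2l; first by rewrite lee_fin invr_ge0.
  apply: lee_sum => eps _; apply: ge_ereal_sup => _ [g hg <-].
  by rewrite lee_fin; exact: signed_model_le.
rewrite sumEFin -EFinM lee_fin -mulr_sumr.
have -> : K * (B / m%:R) = (2 ^ m * m)%:R^-1 * (K * (2 ^+ m * B)).
  by rewrite natrM natrX; field; rewrite mR tm.
apply: ler_wpM2l; first by rewrite invr_ge0.
exact: ler_wpM2l.
Qed.

End Reduction.

Theorem mainTheorem6 (R : realType) (n l m : nat) (mu p : R) (q : \bar R)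
    (X : Type) (rho : X -> 'M[R[i]]_(2 ^ n)) (H : 'M[R[i]]_(2 ^ n))
    (xs : 'I_m -> X) :
  (1 <= l)%N -> (1 <= n)%N -> 0 < mu -> 1 <= p -> (0 < q)%E ->
  adjmx H = H -> \tr H = 0 ->
  (forall x, pure_state (rho x)) ->
  (0 < m)%N ->
  (p <= 2 ->
    (rademacher (model_class rho H l p q mu) xs <=
     (mu * ((Nstr n)%:R `^ (l%:R * Num.max (einv (pstar p)) (einv q)))
         * Num.sqrt (fine (Order.min (pstar p) ((8 * n)%:R)%:E)) / Num.sqrt m%:R
         * Khat p H rho xs)%:E)%E) /\
  (2 < p ->
    (rademacher (model_class rho H l p q mu) xs <=
     (mu * ((Nstr n)%:R `^ (l%:R * Num.max (einv (pstar p)) (einv q)))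
         * Num.sqrt (fine (pstar p)) / (m%:R `^ p^-1)
         * Khat p H rho xs)%:E)%E).
Proof.
move=> _ n1 mu0 p1 q0 _ trH pure m0.
pose a := lpnorm p%:E (@nzstr n) (alpha_hat H).
pose f i := lpnorm (pstar p) (@nzstr n) (fI_hat (rho (xs i))).
pose D := rnorm +oo%E xpredT f.
have KhatE : Khat p H rho xs = a * D by [].
have D0 : 0 <= D by exact: rnorm_ge0.
have hD i : rnorm (pstar p) (@nzstr n) (fun z => `|bloch (rho (xs i)) z|) <= D.
  rewrite -(lpnorm_fI_hat_bloch p xs pure).
  by apply: (@ler_rnorm_coord _ _ xpredT f) => // k; exact: lpnorm_ge0.
have mR : 0 < m%:R :> R by rewrite ltr0n.
have sm0 : Num.sqrt m%:R != 0 :> R by rewrite gt_eqF// sqrtr_gt0.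
have a0 : 0 <= a by exact: lpnorm_ge0.
clearbody D; split=> p2.
- set E := fine _.
  have key : \sum_(eps : {ffun 'I_m -> bool}) rnorm (pstar p) (@nzstr n)
      (fun z => `|signed_sum eps (fun i => bloch (rho (xs i)) z)|)
      <= 2 ^+ m * (Num.sqrt E * Num.sqrt m%:R * D).
    rewrite {}/E; have [h|h] := leP (pstar p) ((8 * n)%:R)%:E.
      have [r rE] : exists r, pstar p = r%:E.
        case: (pstar p) h (pstar_gt0 p1) => [r _ _||].
        - by exists r.
        - by rewrite leye_eq.
        - by move=> _; rewrite ltNge leNye.
      (* Finiteness of [pstar p] excludes [p = 1], and [p <= 2] then means [p / (p - 1) >= 2]. *)
      have r2 : 2 <= r.
        move: rE; rewrite /pstar; case: eqVneq => // pn1 [<-].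
        have p1' : 1 < p by rewrite lt_neqAle eq_sym pn1.
        by rewrite ler_pdivlMr; lra.
      rewrite rE in hD *; exact: rnorm_signed_sum_ge2.
    apply: rnorm_signed_sum_card => //.
      by rewrite card_nzstr /Nstr leq_subr.
    by apply: le_trans (ltW h); rewrite lee_fin ler_nat leq_pmul2r.
  have := rademacher_model_le l n1 mu0 p1 q0 trH pure m0 key.
  move=> /le_trans; apply; rewrite lee_fin KhatE -/a le_eqVlt; apply/orP; left; apply/eqP.
  have := sqr_sqrtr (ltW mR); move: (Num.sqrt m%:R) sm0 => S S0 <-.
  by field.
- have pn1 : p != 1 by lra.
  have rE : pstar p = (p / (p - 1))%:E by rewrite /pstar (negPf pn1).
  set r := p / (p - 1) in rE.
  have r1 : 1 <= r by rewrite ler_pdivlMr; lra.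
  have r2 : r <= 2 by rewrite ler_pdivrMr; lra.
  (* Turns [m^(1/r) / m] into [m^(- 1/p)]. *)
  have rp : r^-1 = 1 - p^-1 by rewrite /r; field; lra.
  have key := rnorm_signed_sum_le2 D0 r1 r2.
  have := rademacher_model_le l n1 mu0 p1 q0 trH pure m0.
  rewrite rE in hD *; move=> /(_ xs _ (key _ _ _ _ hD)).
  move=> /le_trans; apply; rewrite lee_fin KhatE -/a /=.
  rewrite rp powRB ?(gt_eqF mR) ?implybT// powRr1 ?(ltW mR)//.
  set K := mu * _; have K0 : 0 <= K by rewrite mulr_ge0 ?powR_ge0 ?(ltW mu0).
  set M := m%:R `^ _; have M0 : 0 < M by exact: powR_gt0.
  have -> : m%:R / M * D / m%:R = D / M by field; rewrite !gt_eqF.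
  (* For exponents at most 2 the Rademacher bound has constant 1; the factor [sqrt r >= 1] of the
     claim only enlarges it. *)
  have s1 : 1 <= Num.sqrt r by rewrite -[leLHS]sqrtr1 ler_sqrt//; lra.
  have -> : K * Num.sqrt r / M * (a * D) = K * a * (D / M) * Num.sqrt r by ring.
  by apply: ler_peMr s1; rewrite mulr_ge0 ?divr_ge0 ?(ltW M0)// mulr_ge0.
Qed.
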